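(* Consider the linear-quadratic subspace Stackelberg game described in the context and assume that $\varphi$ is convex (jointly in $(x,y)$). Let $L_{J\varphi_e}>0$ be a Lipschitz constant of $\nabla\varphi_e$, let $\alpha^k=\alpha$ for all $k\in\mathbb N$ with $\alpha\in(0,L_{J\varphi_e}^{-1}]$, and let $\{\beta^k\}_{k\in\mathbb N}$ satisfy $0\le\beta^{k+1}\le\beta^k\le1$ for all $k$, $\sum_k\beta^k=\infty$ and $\sum_k(\beta^k)^2<\infty$. Then, for any $x^0\in\mathcal X$, $y^0\in\mathbb R^n$, $s^0\in\mathbb R^{n\times m}$, the sequence $\{x^k\}_{k\in\mathbb N}$ generated by single-loop BIG Hype (defined in the context) converges to a solution of $\min_{x\in\mathcal X}\varphi_e(x)$.
   Context: **Linear-quadratic subspace game.** Followers $i=1,\dots,N$ choose $y_i\in\mathbb R^{n_i}$; $y=(y_1,\dots,y_N)\in\mathbb R^n$, $n=\sum_in_i$. The leader chooses $x\in\mathcal X\subseteq\mathbb R^m$. Follower $i$ minimizes $f_i(x,y)=\tfrac12y_i^\top Q_iy_i+\big(\sum_{j=1}^NE_{i,j}y_j+E_{i,0}x+e_i\big)^\top y_i$ (with $Q_i$ symmetric positive definite) over $y_i\in\mathcal Y_i(x):=\{y_i:C_iy_i=d_i+H_ix\}$, where $C_i$ has full row rank. As a function of $y_i$, $f_i$ is assumed convex. Let $\mathcal Y(x)=\prod_i\mathcal Y_i(x)$ and let $F(x,y)=(\nabla_{y_i}f_i(x,y))_{i=1}^N$ be the (affine) pseudo-gradient, assumed $\mu$-strongly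 monotone ($\mu>0$) and $L_F$-Lipschitz in $y$. **Leader.** $\varphi:\mathbb R^m\times\mathbb R^n\to\mathbb R$ is definable (in a fixed o-minimal structure expanding the real field) and continuously differentiable, with Lipschitz partial gradients $\nabla_1\varphi,\nabla_2\varphi$; $\mathcal X$ is nonempty, convex and compact. **Solution map.** $y^\star(x)$ is the unique solution of the variational inequality $\mathrm{VI}(F(x,\cdot),\mathcal Y(x))$ (the unique Nash equilibrium); it is affine in $x$: $y^\star(x)=Wx+w$. Put $\varphi_e(x)=\varphi(x,y^\star(x))$, whose gradient is Lipschitz. Fix $0<\gamma<2\mu/L_F^2$ and let $h(x,y)=\mathbb P_{\mathcal Y(x)}[y-\gamma F(x,y)]$ (Euclidean projection); $h$ is affine in $(x,y)$, with constant partial Jacobians $\mathrm J_1h\in\mathbb R^{n\times m}$ and $\mathrm J_2h\in\mathbb R^{n\times n}$. **Single-loop BIG Hype.** For $k=0,1,\dots$: $\widehat\nabla\varphi_e^k=\nabla_1\varphi(x^k,y^k)+(s^k)^\top\nabla_2\varphi(x^k,y^k)$; $x^{k+1}=x^k+\beta^k\big(\mathbb P_{\mathcal X}[x^k-\alpha^k\widehat\nabla\varphi_e^k]-x^k\big)$; $y^{k+1}=h(x^{k+1},y^k)$; $s^{k+1}=\mathrm J_2h\,s^k+\mathrm J_1h$. *)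

(* Defs.v *)
From HB Require Import structures.
From mathcomp Require Import all_boot all_order all_algebra.
From mathcomp Require Import all_classical all_reals all_analysis.
(* Not imported: its notations clash with those of all_analysis. *)
From mathcomp Require mpoly.
Set Implicit Arguments.
Unset Strict Implicit.
Unset Printing Implicit Defensive.
Import Order.TTheory GRing.Theory Num.Theory.
Import numFieldNormedType.Exports.
Local Open Scope classical_set_scope.
Local Open Scope ring_scope.

(* Points of R^p are column vectors.
   The library norm on matrices is the sup norm. It induces the same topology,
   differentials and existential Lipschitz property ([lipschitz]) as [enorm],
   but projections and explicit constants below refer to the Euclidean norm. *)
Definition inner (R : realType) (p : nat) (u v : 'cV[R]_p) : R :=
  \sum_i u i 0 * v i 0.

Definition enorm (R : realType) (p : nat) (u : 'cV[R]_p) : R :=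
  Num.sqrt (inner u u).

Definition euclid_lipschitz (R : realType) (p q : nat) (L : R)
    (f : 'cV[R]_p -> 'cV[R]_q) : Prop :=
  forall u v, enorm (f u - f v) <= L * enorm (u - v).

Definition strongly_monotone (R : realType) (p : nat) (mu : R)
    (f : 'cV[R]_p -> 'cV[R]_p) : Prop :=
  forall u v, mu * enorm (u - v) ^+ 2 <= inner (f u - f v) (u - v).

Definition sym_posdef (R : realType) (p : nat) (A : 'M[R]_p) : Prop :=
  A^T = A /\ forall v : 'cV[R]_p, v != 0 -> 0 < inner v (A *m v).

(* Both operators below are total: the value is 0 when no such point exists. *)
Definition proj (R : realType) (p : nat) (A : set 'cV[R]_p) (u : 'cV[R]_p) :
    'cV[R]_p :=
  xget 0 [set v | A v /\ forall w, A w -> enorm (u - v) <= enorm (u - w)].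

Definition VI_sol (R : realType) (p : nat) (f : 'cV[R]_p -> 'cV[R]_p)
    (A : set 'cV[R]_p) : 'cV[R]_p :=
  xget 0 [set v | A v /\ forall w, A w -> 0 <= inner (f v) (w - v)].

Definition grad (R : realType) (p : nat) (f : 'cV[R]_p -> R) (u : 'cV[R]_p) :
    'cV[R]_p :=
  \col_i 'D_(delta_mx i 0) f u.

(* The library [jacobian] is for row vectors, and is the transpose of this. *)
Definition Jac (R : realType) (p q : nat) (f : 'cV[R]_p -> 'cV[R]_q)
    (u : 'cV[R]_p) : 'M[R]_(q, p) :=
  \matrix_(i, j) ('D_(delta_mx j 0) f u) i 0.

Definition continuously_differentiable (R : realType) (V W : normedModType R)
    (f : V -> W) : Prop :=
  (forall z, differentiable f z) /\ (forall v, continuous ('D_v f)).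

(* O-minimal structure expanding the real field; the field operations and real
   constants enter through [omin_algebraic]. *)
Record ominimal (R : realType) := OMinimal {
  omin_sets : forall p, set (set 'cV[R]_p);
  omin_setT : forall p, omin_sets [set: 'cV[R]_p];
  omin_setC : forall p (A : set 'cV[R]_p), omin_sets A -> omin_sets (~` A);
  omin_setU : forall p (A B : set 'cV[R]_p),
    omin_sets A -> omin_sets B -> omin_sets (A `|` B);
  omin_prodr : forall p (A : set 'cV[R]_p), omin_sets A ->
    omin_sets [set u : 'cV[R]_(p + 1) | A (usubmx u)];
  omin_prodl : forall p (A : set 'cV[R]_p), omin_sets A ->
    omin_sets [set u : 'cV[R]_(1 + p) | A (dsubmx u)];
  omin_proj : forall p (A : set 'cV[R]_(p + 1)), omin_sets A ->
    omin_sets [set usubmx u | u in A];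
  omin_algebraic : forall p (g : mpoly.mpoly p R),
    omin_sets [set u : 'cV[R]_p | mpoly.meval (fun i => u i 0) g = 0];
  omin_tame : forall A : set 'cV[R]_1, omin_sets A <->
    exists s : seq (interval R),
      A = [set u | has (fun I : interval R => u 0 0 \in I) s]
}.

Definition definable (R : realType) (S : ominimal R) (m n : nat)
    (f : 'cV[R]_m * 'cV[R]_n -> R) : Prop :=
  omin_sets S
    [set col_mx (col_mx z.1 z.2) (f z)%:M | z in [set: 'cV[R]_m * 'cV[R]_n]].

(* Data of a linear-quadratic subspace game: follower [i] controls a vector of
   R^(n_ i), subject to [p_ i] equality constraints. *)
Record lqgame (R : realType) (m N : nat) (n_ p_ : 'I_N -> nat) := LQGame {
  lqQ : forall i, 'M[R]_(n_ i);
  lqE : forall i j, 'M[R]_(n_ i, n_ j);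
  lqE0 : forall i, 'M[R]_(n_ i, m);
  lqe : forall i, 'cV[R]_(n_ i);
  lqC : forall i, 'M[R]_(p_ i, n_ i);
  lqd : forall i, 'cV[R]_(p_ i);
  lqH : forall i, 'M[R]_(p_ i, m)
}.

Section Game.
Context (R : realType) (m N : nat) (n_ p_ : 'I_N -> nat).
Context (G : lqgame R m n_ p_).
Local Notation n := (\sum_i n_ i)%N.
Implicit Types (x : 'cV[R]_m) (y : 'cV[R]_n).

(* Follower [i]'s strategy is the block [submxcol y i]. *)
Definition cost (i : 'I_N) x y : R :=
  2^-1 * inner (submxcol y i) (lqQ G i *m submxcol y i)
  + inner (\sum_j lqE G i j *m submxcol y j + lqE0 G i *m x + lqe G i)
          (submxcol y i).

Definition set_block y (i : 'I_N) (v : 'cV[R]_(n_ i)) : 'cV[R]_n :=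
  \mxcol_j @dfwith _ (fun k => 'cV[R]_(n_ k)) (submxcol y) i v j.

Definition feasible x : set 'cV[R]_n :=
  [set y | forall i, lqC G i *m submxcol y i = lqd G i + lqH G i *m x].

Definition pseudo_grad x y : 'cV[R]_n :=
  \mxcol_i grad (fun v => cost i x (set_block y v)) (submxcol y i).

Definition ystar x : 'cV[R]_n := VI_sol (pseudo_grad x) (feasible x).

Definition hmap (gamma : R) x y : 'cV[R]_n :=
  proj (feasible x) (y - gamma *: pseudo_grad x y).

Definition J1h (gamma : R) x y : 'M[R]_(n, m) := Jac (fun x' => hmap gamma x' y) x.

Definition J2h (gamma : R) x y : 'M[R]_n := Jac (hmap gamma x) y.

Context (phi : 'cV[R]_m * 'cV[R]_n -> R).

Definition grad1 (z : 'cV[R]_m * 'cV[R]_n) : 'cV[R]_m :=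
  grad (fun x => phi (x, z.2)) z.1.

Definition grad2 (z : 'cV[R]_m * 'cV[R]_n) : 'cV[R]_n :=
  grad (fun y => phi (z.1, y)) z.2.

Definition phi_e x : R := phi (x, ystar x).

Definition hypergrad x y (s : 'M[R]_(n, m)) : 'cV[R]_m :=
  grad1 (x, y) + s^T *m grad2 (x, y).

(* The triple (x^k, y^k, s^k). The map [hmap gamma] is affine in (x, y), so its
   partial Jacobians do not depend on the point at which they are taken. *)
Fixpoint big_hype (X : set 'cV[R]_m) (gamma : R) (alpha beta : nat -> R)
    (x0 : 'cV[R]_m) (y0 : 'cV[R]_n) (s0 : 'M[R]_(n, m)) (k : nat) :
    'cV[R]_m * 'cV[R]_n * 'M[R]_(n, m) :=
  if k is k'.+1 then
    let: (x, y, s) := big_hype X gamma alpha beta x0 y0 s0 k' in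
    let x' := x + beta k' *:
      (proj X (x - alpha k' *: hypergrad x y s) - x) in
    (x', hmap gamma x' y, J2h gamma x' y *m s + J1h gamma x' y)
  else (x0, y0, s0).

End Game.

(* Main.v *)
Require Import Defs.
From HB Require Import structures.
From mathcomp Require Import all_boot all_order all_algebra.
From mathcomp Require Import all_classical all_reals all_analysis.
From mathcomp Require Import ring lra.
Import Order.TTheory GRing.Theory Num.Theory.
Import numFieldNormedType.Exports.
Local Open Scope classical_set_scope.
Local Open Scope ring_scope.

(** The constraints confine the followers to a fixed linear subspace up to an
    affine shift depending on x; with Z the orthogonal projection on that
    subspace, the maps y*(x) = W x + w and h are explicit affine maps, and
    J_2 h = Z (1 - gamma M) is a kappa-contraction with kappa < 1. Hence s^k - W
    decays like kappa^k, while e_k = |y^k - y*(x^k)| satisfies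
    e_(k+1) <= kappa e_k + C beta^k since |x^(k+1) - x^k| <= diam(X) beta^k.
    As beta is nonincreasing and square summable, the hypergradient errors are
    summable against beta.
    The outer loop is then an inexact projected gradient method for the convex
    function phi_e. The descent lemma, convexity and the obtuse angle property
    of the projection give, for every minimizer z and p^k the projected step,
      |x^(k+1) - z|^2 + 2 alpha beta^k (phi_e(p^k) - phi_e(z))
        <= |x^k - z|^2 + (summable).
    So the sum of the beta^k (phi_e(x^k) - min phi_e) converges; as the sum of
    the beta^k diverges, some cluster point of x^k is a minimizer, and
    quasi-Fejer monotonicity with respect to that point gives convergence. *)

(** * Euclidean geometry *)

Section Euclidean.
Context {R : realType} {p : nat}.
Implicit Types (u v w : 'cV[R]_p) (a : R).

Lemma innerE u v : inner u v = (u^T *m v) 0 0.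
Proof. by rewrite mxE; apply: eq_bigr => i _; rewrite mxE. Qed.

Lemma innerC u v : inner u v = inner v u.
Proof. by apply: eq_bigr => i _; rewrite mulrC. Qed.

Lemma innerDl u v w : inner (u + v) w = inner u w + inner v w.
Proof. by rewrite -big_split; apply: eq_bigr => i _; rewrite mxE mulrDl. Qed.

Lemma innerDr u v w : inner w (u + v) = inner w u + inner w v.
Proof. by rewrite innerC innerDl !(innerC w). Qed.

Lemma innerZl a u v : inner (a *: u) v = a * inner u v.
Proof. by rewrite mulr_sumr; apply: eq_bigr => i _; rewrite mxE mulrA. Qed.

Lemma innerZr a u v : inner u (a *: v) = a * inner u v.
Proof. by rewrite innerC innerZl innerC. Qed.

Lemma innerNl u v : inner (- u) v = - inner u v.
Proof. by rewrite -scaleN1r innerZl mulN1r. Qed.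

Lemma innerNr u v : inner u (- v) = - inner u v.
Proof. by rewrite innerC innerNl innerC. Qed.

Lemma inner0l v : inner 0 v = 0.
Proof. by rewrite -(scale0r 0) innerZl mul0r. Qed.

Definition inner_lin := (innerDl, innerDr, innerNl, innerNr, innerZl, innerZr).

Lemma inner_ge0 u : 0 <= inner u u.
Proof. by apply: sumr_ge0 => i _; rewrite -expr2 sqr_ge0. Qed.

Lemma inner_eq0 u : inner u u = 0 -> u = 0.
Proof.
move=> /eqP; rewrite psumr_eq0 => [/allP h|i _]; last by rewrite -expr2 sqr_ge0.
apply/colP => i; apply/eqP.
by have := h i (mem_index_enum _); rewrite mulf_eq0 orbb mxE.
Qed.

Lemma inner_delta u (i : 'I_p) : inner u (delta_mx i 0) = u i 0.
Proof.
rewrite /inner (bigD1 i)//= big1 => [|j ji]; rewrite mxE ?eqxx ?mulr1 ?addr0//.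
by rewrite (negbTE ji) mulr0.
Qed.

Lemma enorm_ge0 u : 0 <= enorm u.
Proof. exact: sqrtr_ge0. Qed.

Lemma enorm_sqr u : enorm u ^+ 2 = inner u u.
Proof. by rewrite sqr_sqrtr// inner_ge0. Qed.

Lemma enorm0 : enorm (0 : 'cV[R]_p) = 0.
Proof. by rewrite /enorm inner0l sqrtr0. Qed.

Lemma enorm_eq0 u : enorm u = 0 -> u = 0.
Proof. by move=> u0; apply: inner_eq0; rewrite -enorm_sqr u0 expr0n. Qed.

Lemma enormZ a u : enorm (a *: u) = `|a| * enorm u.
Proof.
by rewrite /enorm innerZl innerZr mulrA -expr2 sqrtrM ?sqr_ge0// sqrtr_sqr.
Qed.

Lemma enormN u : enorm (- u) = enorm u.
Proof. by rewrite -scaleN1r enormZ normrN1 mul1r. Qed.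

Lemma enormB u v : enorm (u - v) = enorm (v - u).
Proof. by rewrite -enormN opprB. Qed.

(** Expand the square of |v| u - |u| v, which is nonnegative, and divide by |u| |v|. A zero vector
    is treated apart. *)
Lemma cauchy_schwarz u v : inner u v <= enorm u * enorm v.
Proof.
have [/enorm_eq0->|u0] := eqVneq (enorm u) 0.
  by rewrite inner0l enorm0 mul0r.
have [/enorm_eq0->|v0] := eqVneq (enorm v) 0.
  by rewrite innerC inner0l enorm0 mulr0.
have : 0 < enorm u * enorm v.
  by rewrite mulr_gt0// lt_neqAle eq_sym enorm_ge0 ?u0 ?v0.
have := inner_ge0 (enorm v *: u - enorm u *: v).
rewrite !inner_lin (innerC v) -!enorm_sqr => h uv.
rewrite -subr_ge0 -(pmulr_rge0 _ uv); nra.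
Qed.

Lemma enormD u v : enorm (u + v) <= enorm u + enorm v.
Proof.
rewrite -(@ler_pXn2r _ 2)// ?nnegrE ?addr_ge0 ?enorm_ge0//.
rewrite enorm_sqr !inner_lin (innerC v) sqrrD !enorm_sqr.
have := cauchy_schwarz u v; lra.
Qed.

Lemma enorm_le_sqr u a : 0 <= a -> inner u u <= a ^+ 2 -> enorm u <= a.
Proof. by move=> a0; rewrite -enorm_sqr ler_pXn2r// nnegrE enorm_ge0. Qed.

Lemma norm_le_enorm u : `|u| <= enorm u.
Proof.
rewrite [`|u|]mx_normrE; apply/bigmax_leP; split; first exact: enorm_ge0.
case=> i j _ /=; rewrite (ord1 j).
rewrite -(@ler_pXn2r _ 2)// ?nnegrE ?normr_ge0 ?enorm_ge0//.
rewrite enorm_sqr real_normK ?num_real//.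
rewrite /inner (bigD1 i)//= -expr2 lerDl sumr_ge0// => k _.
by rewrite -expr2 sqr_ge0.
Qed.

(** Passes from the sup norm of the library topology to Euclidean estimates. The crude factor p
    suffices, as only the existence of a constant matters. *)
Lemma enorm_le_norm u : enorm u <= p%:R * `|u|.
Proof.
apply: enorm_le_sqr; first by rewrite mulr_ge0.
apply: (@le_trans _ _ (\sum_(i < p) `|u| ^+ 2)).
  apply: ler_sum => i _; rewrite -expr2 -(real_normK (num_real (u i 0))).
  rewrite ler_pXn2r// ?nnegrE// [leRHS]mx_normrE.
  exact: (le_bigmax _ (fun ij : 'I_p * 'I_1 => `|u ij.1 ij.2|) (i, 0)).
rewrite sumr_const card_ord -[_ *+ p]mulr_natl exprMn ler_wpM2r ?sqr_ge0//.
by rewrite -natrX ler_nat; case: (p) => // k; rewrite leq_pmulr.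
Qed.

End Euclidean.

Lemma inner_mulmx {R : realType} {p q : nat} (A : 'M[R]_(q, p)) u v :
  inner u (A *m v) = inner (A^T *m u) v.
Proof. by rewrite !innerE trmx_mul trmxK mulmxA. Qed.

(** The constant is the Frobenius norm: apply Cauchy-Schwarz to each row. *)
Lemma mulmx_enorm_bound {R : realType} {p q : nat} (A : 'M[R]_(q, p)) :
  exists2 c, 0 <= c & forall v, enorm (A *m v) <= c * enorm v.
Proof.
exists (Num.sqrt (\sum_i enorm ((row i A)^T) ^+ 2)); first exact: sqrtr_ge0.
move=> v; apply: enorm_le_sqr; first by rewrite mulr_ge0 ?sqrtr_ge0 ?enorm_ge0.
rewrite exprMn sqr_sqrtr; last by apply: sumr_ge0 => i _; rewrite sqr_ge0.
rewrite mulr_suml; apply: ler_sum => i _.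
have -> : (A *m v) i 0 = inner ((row i A)^T) v.
  by rewrite innerE trmxK -row_mul [RHS]mxE.
have h1 := cauchy_schwarz ((row i A)^T) v.
(* The negated row gives the lower bound, so that -a <= b <= a and b^2 <= a^2. *)
have := cauchy_schwarz (- (row i A)^T) v; rewrite innerNl enormN => h2.
have := mulr_ge0 (enorm_ge0 ((row i A)^T)) (enorm_ge0 v).
rewrite -exprMn; move: h1 h2; set a := _ * enorm v; set b := inner _ _; nra.
Qed.

(** Since |A^T u|^2 = <u, A A^T u> <= |u| c |A^T u|, one factor |A^T u| cancels. *)
Lemma trmx_enorm_bound {R : realType} {p q : nat} (A : 'M[R]_(q, p)) c :
  0 <= c -> (forall v, enorm (A *m v) <= c * enorm v) ->
  forall u, enorm (A^T *m u) <= c * enorm u.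
Proof.
move=> c0 hA u; have [->|t0] := eqVneq (enorm (A^T *m u)) 0.
  by rewrite mulr_ge0 ?enorm_ge0.
have {}t0 : 0 < enorm (A^T *m u) by rewrite lt_neqAle eq_sym t0 enorm_ge0.
rewrite -(ler_pM2r t0) -expr2 enorm_sqr -inner_mulmx.
apply: le_trans (cauchy_schwarz _ _) _; rewrite mulrC mulrAC ler_wpM2r ?enorm_ge0//.
Qed.

Lemma enorm_continuous {R : realType} {p : nat} (a : 'cV[R]_p) :
  continuous (fun v : 'cV[R]_p => enorm (a - v)).
Proof.
move=> v; apply/(@cvgrPdist_le _ _ _ (nbhs v) (nbhs_filter v)) => e e0.
(* The denominator p + 1 also covers dimension 0. *)
have e1 : 0 < e / p.+1%:R by rewrite divr_gt0.
apply: filterS (nbhsx_ballx v _ e1) => w; rewrite -ball_normE/= => vw.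
apply: (@le_trans _ _ (p%:R * `|v - w|)).
  apply: le_trans (enorm_le_norm _).
  have h1 := enormD (a - v) (v - w); have h2 := enormD (a - w) (w - v).
  rewrite ler_norml; move: h1 h2; rewrite !addrA !subrK (enormB w v); lra.
apply: (@le_trans _ _ (p.+1%:R * `|v - w|)).
  by rewrite ler_wpM2r// ler_nat.
by rewrite mulrC -ler_pdivlMr// ltW.
Qed.

Lemma convex_setE {R : realType} {p : nat} (X : set 'cV[R]_p) :
  convex_set X -> forall x y t, X x -> X y -> 0 <= t <= 1 ->
  X (x + t *: (y - x)).
Proof.
move=> cX x y t Xx Xy /andP[t0 t1].
have /set_mem := cX y x (Itv01 t0 t1) (mem_set Xy) (mem_set Xx).
have -> // : x + t *: (y - x) = t *: y + (1 - t) *: x.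
by rewrite scalerBr scalerBl scale1r addrCA.
Qed.

Lemma convex_functionE {R : realType} {V : lmodType R} (f : V -> R) :
  convex_function setT f -> forall x y t, 0 <= t <= 1 ->
  f (x + t *: (y - x)) <= f x + t * (f y - f x).
Proof.
move=> cf x y t /andP[t0 t1].
have := cf (Itv01 t0 t1) y x (mem_set I) (mem_set I).
have -> : x + t *: (y - x) = t *: y + (1 - t) *: x.
  by rewrite scalerBr scalerBl scale1r addrCA.
have -> // : f x + t * (f y - f x) = t * f y + (1 - t) * f x by ring.
Qed.

(** * Euclidean projection: characterization, existence and obtuse angles *)

Section Projection.
Context {R : realType} {p : nat}.
Implicit Types (X : set 'cV[R]_p) (u v w : 'cV[R]_p).

(* [proj] alone would be the library projection of a product topology. *)
Lemma proj_unique X u v : X v -> (forall w, X w -> inner (u - v) (w - v) <= 0) ->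
  Defs.proj X u = v.
Proof.
move=> Xv hv; apply: (@xget_unique _ 0 [set v | X v /\ forall w, X w -> _]).
  split=> // w Xw; apply: enorm_le_sqr; first exact: enorm_ge0.
  rewrite enorm_sqr.
  have := hv w Xw; have := inner_ge0 (v - w); rewrite !inner_lin.
  rewrite (innerC v u) (innerC w u) (innerC w v); lra.
move=> w [Xw hw].
have := hw v Xv; rewrite -(@ler_pXn2r _ 2)// ?nnegrE ?enorm_ge0// !enorm_sqr => h.
apply/eqP; rewrite -subr_eq0; apply/eqP; apply: inner_eq0; apply/le_anti.
rewrite inner_ge0 andbT; have := hv w Xw; move: h; rewrite !inner_lin.
rewrite (innerC v u) (innerC w u) (innerC w v); lra.
Qed.

Lemma proj_in X u : X !=set0 -> compact X -> X (Defs.proj X u) /\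
  forall w, X w -> enorm (u - Defs.proj X u) <= enorm (u - w).
Proof.
move=> X0 cX; apply: (@xgetPex _ 0 [set v | X v /\ forall w, X w -> _]).
have [v vX hv] := compact_EVT_min X0 cX
  (continuous_subspaceT (enorm_continuous u)).
by exists v; split; [exact: set_mem | move=> w Xw; apply: hv; exact: mem_set].
Qed.

(** If the angle were acute, moving from the projection towards w would stay in X by convexity and
    come closer to u. *)
Lemma proj_inner_le0 X u w : X !=set0 -> compact X -> convex_set X -> X w ->
  inner (u - Defs.proj X u) (w - Defs.proj X u) <= 0.
Proof.
move=> X0 cX /convex_setE vX Xw; have [Xp hp] := proj_in X u X0 cX.
move: (Defs.proj X u) Xp hp => v Xv hv; rewrite leNgt; apply/negP => h.
set a := inner _ _ in h; set b := inner (w - v) (w - v).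
have b0 : 0 <= b := inner_ge0 _.
have ab0 : 0 < a + b by lra.
(* The squared distance drops by t (2 a - t b), which is positive for this t, since t b < a. *)
pose t := a / (a + b).
have t01 : 0 <= t <= 1.
  by rewrite divr_ge0 ?(ltW h) ?(ltW ab0)//= ler_pdivrMr// mul1r lerDl.
have := hv _ (vX v w t Xv Xw t01).
rewrite -(@ler_pXn2r _ 2)// ?nnegrE ?enorm_ge0// !enorm_sqr.
rewrite opprD addrA innerDl !(innerDr (u - v)) !(innerDl _ (- (t *: _))).
rewrite (innerC (- (t *: _))) !inner_lin -/a -/b.
suff : 0 < t * (2 * a - t * b) by rewrite /a /b !inner_lin; lra.
rewrite mulr_gt0 ?divr_gt0// subr_gt0 /t mulrAC ltr_pdivrMr//; nra.
Qed.

End Projection.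

(** * Gradients *)

Section Gradient.
Context {R : realType}.

(** The difference quotient is exactly a + h c. This serves affine maps (c = 0) and the followers'
    costs. *)
Lemma is_derive_quadratic {V W : normedModType R} (f : V -> W) x d (a c : W) :
  (forall h : R, f (x + h *: d) = f x + h *: a + (h ^+ 2) *: c) ->
  is_derive x d f a.
Proof.
move=> hf; suff h : h^-1 *: ((f \o shift x) (h *: d) - f x) @[h --> 0^'] --> a.
  by split; [apply/cvg_ex; exists a | exact/cvg_lim].
have h : a + h *: c @[h --> (0:R)^'] --> a.
  rewrite -[X in _ --> X]addr0; apply: cvgD; first exact: cvg_cst.
  rewrite -(scale0r c); apply: cvg_within_filter.
  by apply: cvgZr_tmp; exact: cvg_id.
apply: cvg_trans h; apply: near_eq_cvg; near=> t.
have t0 : t != 0 by near: t; exact: nbhs_dnbhs_neq.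
rewrite /= (addrC _ x) hf -(addrA (f x)) (addrC (f x)) addrK scalerDr !scalerA mulVf//.
by rewrite scale1r expr2 mulrA mulVf// mul1r.
Unshelve. all: by end_near. Qed.

Lemma is_derive_line {V W : normedModType R} (f : V -> W) x d t :
  differentiable f (x + t *: d) ->
  is_derive t (1 : R) (fun s => f (x + s *: d)) ('D_d f (x + t *: d)).
Proof.
move=> df; have dvf : derivable f (x + t *: d) d by exact: diff_derivable.
have E : (fun h : R => h^-1 *: (((fun s => f (x + s *: d)) \o shift t) (h *: 1)
    - f (x + t *: d))) =
  (fun h => h^-1 *: ((f \o shift (x + t *: d)) (h *: d) - f (x + t *: d))).
  apply/funext => h; congr (_ *: (f _ - _)) => /=.
  by have -> : h *: (1 : R) = h; [exact: mulr1 | rewrite scalerDl addrCA].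
by split; [rewrite /derivable E | rewrite /derive E].
Qed.

Context {p : nat}.
Implicit Types (f : 'cV[R]_p -> R) (x y d : 'cV[R]_p).

Lemma derive_grad f x d : differentiable f x -> 'D_d f x = inner (grad f x) d.
Proof.
move=> df; rewrite deriveE// {1}(matrix_sum_delta d) linear_sum.
apply: eq_bigr => i _; rewrite big_ord1 linearZ/= mxE deriveE//.
by rewrite /GRing.scale/= mulrC.
Qed.

(** For 0 < t <= 1 the difference quotients along y - x are at most f y - f x; let t tend to 0 from
    the right. *)
Lemma convex_grad_le f x y :
  (forall t, 0 <= t <= 1 -> f (x + t *: (y - x)) <= f x + t * (f y - f x)) ->
  differentiable f x -> inner (grad f x) (y - x) <= f y - f x.
Proof.
move=> cf df; rewrite -derive_grad//.
have /cvg_dnbhs_at_right h : derivable f x (y - x) by exact: diff_derivable.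
have <- : _ = 'D_(y - x) f x := cvg_lim (@Rhausdorff R) h.
apply: limr_le; first by apply/cvg_ex; eexists; exact: h.
near=> t; have t0 : 0 < t by near: t; exact: nbhs_right_gt.
have t1 : t <= 1 by near: t; exact: nbhs_right_le.
rewrite /= (addrC _ x) /GRing.scale/= mulrC ler_pdivrMr// lerBlDl mulrC.
by apply: cf; rewrite (ltW t0).
Unshelve. all: by end_near. Qed.

(** Mean value theorem on [0, 1] for t |-> f (x + t d) - t a - t^2 c: by Cauchy-Schwarz and the
    Lipschitz gradient its derivative is nonpositive. *)
Lemma descent_lemma f L x y : (forall z, differentiable f z) ->
  euclid_lipschitz L (grad f) ->
  f y <= f x + inner (grad f x) (y - x) + L / 2 * enorm (y - x) ^+ 2.
Proof.
move=> df hL; set d := y - x; set a := inner _ d; set c := L / 2 * _.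
pose g t := f (x + t *: d).
pose q (t : R) := t * a + t ^+ 2 * c.
have dg (t : R) : is_derive t (1 : R) (g - q) ('D_d f (x + t *: d) - (a + 2 * t * c)).
  apply: is_deriveB; first exact: is_derive_line.
  apply: (@is_derive_quadratic _ _ _ _ _ _ c) => h.
  by rewrite /q /GRing.scale/= mulr1; ring.
have cg : {within `[0, 1], continuous (g - q)}.
  apply: derivable_within_continuous => t _; exact: ex_derive.
have [t t01] := MVT_segment ler01 (fun t _ => dg t) cg.
rewrite subr0 mulr1 derive_grad// /q /g !fctE => h.
suff : inner (grad f (x + t *: d)) d - (a + 2 * t * c) <= 0.
  rewrite -h scale1r scale0r addr0 /d (addrC x) subrK; lra.
have -> : inner (grad f (x + t *: d)) d - (a + 2 * t * c) =
   inner (grad f (x + t *: d) - grad f x) d - 2 * t * c.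
  by rewrite innerDl innerNl -/a; ring.
rewrite subr_le0; apply: le_trans (cauchy_schwarz _ _) _.
move: t01; rewrite in_itv/= => /andP[t0 _].
apply: le_trans (ler_wpM2r (enorm_ge0 _) (hL _ _)) _.
rewrite (addrC x) addrK enormZ ger0_norm// /c.
suff -> : L * (t * enorm d) * enorm d = 2 * t * (L / 2 * enorm d ^+ 2) by [].
by field.
Qed.

End Gradient.

(** * Inexact projected gradient *)

Section RealSeries.
Context {R : realType}.
Implicit Types (a b c d : nat -> R) (e B M : R).

Lemma nneseries_bounded c : (forall k, 0 <= c k) ->
  (\sum_(0 <= k <oo) (c k)%:E < +oo)%E ->
  exists B, forall n, \sum_(0 <= k < n) c k <= B.
Proof.
move=> c0 cfin; exists (fine (\sum_(0 <= k <oo) (c k)%:E)%E) => n.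
rewrite -lee_fin fineK; last first.
  by rewrite ge0_fin_numE//; apply: nneseries_ge0 => k _ _; rewrite lee_fin.
by rewrite -sumEFin; apply: nneseries_lim_ge => k _ _; rewrite lee_fin.
Qed.

Lemma nneseries_unbounded c : (forall k, 0 <= c k) ->
  (\sum_(0 <= k <oo) (c k)%:E = +oo)%E ->
  forall M, exists n, M < \sum_(0 <= k < n) c k.
Proof.
move=> c0 cinf M; apply: contrapT => /forallNP h.
suff : (\sum_(0 <= k <oo) (c k)%:E <= M%:E)%E by rewrite cinf.
apply: lime_le; first by apply: is_cvg_nneseries => k _ _; rewrite lee_fin.
apply: nearW => n; rewrite sumEFin lee_fin leNgt; exact/negP.
Qed.

(** Some partial sum is within e of the supremum, which no later partial sum exceeds. *)
Lemma sum_tail_lt b B e : (forall k, 0 <= b k) ->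
  (forall n, \sum_(0 <= k < n) b k <= B) -> 0 < e ->
  exists K, forall n, (K <= n)%N -> \sum_(K <= k < n) b k < e.
Proof.
move=> b0 bB e0.
pose A := range (fun n => \sum_(0 <= k < n) b k).
have ubA : ubound A B by move=> _ [n _ <-].
have hA : has_sup A by split; [exists (\sum_(0 <= k < 0) b k), 0%N | exists B].
have [_ [K _ <-] hK] := sup_adherent e0 hA.
exists K => n Kn; have : \sum_(0 <= k < n) b k <= sup A.
  by apply: ub_le_sup; [exists B | exists n].
rewrite (big_cat_nat (leq0n K) Kn)/=; lra.
Qed.

(** Start where the tail of b is below e / 2 and wait until a drops below e / 2: the remaining
    increments cannot lift it to e. This is the scalar form of the quasi-Fejer argument. *)
Lemma quasi_monotone_cvg0 a b B : (forall k, 0 <= b k) ->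
  (forall n, \sum_(0 <= k < n) b k <= B) ->
  (forall k, a k.+1 <= a k + b k) ->
  (forall e K, 0 < e -> exists2 k, (K <= k)%N & a k < e) ->
  forall e, 0 < e -> exists K, forall k, (K <= k)%N -> a k < e.
Proof.
move=> b0 bB ab hinf e e0; have e2 : 0 < e / 2 by rewrite divr_gt0.
have [K hK] := sum_tail_lt _ _ _ b0 bB e2.
have [k0 Kk0 ak0] := hinf _ K e2; exists k0 => k k0k.
suff : a k <= a k0 + \sum_(k0 <= i < k) b i.
  have := hK k (leq_trans Kk0 k0k); rewrite (big_cat_nat Kk0 k0k)/=.
  have : 0 <= \sum_(K <= i < k0) b i by apply: sumr_ge0.
  lra.
elim: k k0k => [|k IH]; first by rewrite leqn0 => /eqP->; rewrite big_nil addr0.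
rewrite leq_eqVlt => /orP[/eqP<-|]; first by rewrite big_geq// addr0.
rewrite ltnS => k0k; rewrite big_nat_recr//=; have := ab k; have := IH k0k; lra.
Qed.

(** If d stayed above e from K on, the sums of c beyond K would be at most B / e, against
    divergence. *)
Lemma weighted_sum_liminf0 c d B : (forall k, 0 <= c k) -> (forall k, 0 <= d k) ->
  (forall M, exists n, M < \sum_(0 <= k < n) c k) ->
  (forall n, \sum_(0 <= k < n) c k * d k <= B) ->
  forall e K, 0 < e -> exists2 k, (K <= k)%N & d k < e.
Proof.
move=> c0 d0 cinf cdB e K e0; apply: contrapT => /forall2NP h.
have de k : (K <= k)%N -> e <= d k.
  by move=> Kk; rewrite leNgt; apply/negP; case: (h k).
have B0 : 0 <= B by have := cdB 0%N; rewrite big_nil.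
have [n hn] := cinf (B / e + \sum_(0 <= k < K) c k).
have cM j l : (j <= l)%N -> \sum_(0 <= k < j) c k <= \sum_(0 <= k < l) c k.
  by move=> jl; rewrite [leRHS](big_cat_nat (leq0n j) jl)/= lerDl sumr_ge0.
have [Kn|nK] := leqP K n; last first.
  by have := cM _ _ (ltnW nK); have := divr_ge0 B0 (ltW e0); lra.
move: hn; rewrite (big_cat_nat (leq0n K) Kn)/= => hn.
suff : \sum_(K <= k < n) c k <= B / e by lra.
rewrite ler_pdivlMr//; apply: le_trans (cdB n).
rewrite [leRHS](big_cat_nat (leq0n K) Kn)/= ler_wpDl//.
  by apply: sumr_ge0 => k _; rewrite mulr_ge0.
rewrite mulr_suml; apply: ler_sum_nat => k /andP[Kk _].
by rewrite ler_wpM2l// de.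
Qed.

End RealSeries.

(** * Convergence of projected gradient iterations with summable weighted errors *)

Section InexactProjectedGradient.
Context {R : realType} {p : nat}.
Context (X : set 'cV[R]_p) (f : 'cV[R]_p -> R) (L alpha : R).
Hypotheses (X0 : X !=set0) (Xcpt : compact X) (Xcvx : convex_set X).
Hypotheses (df : forall z, differentiable f z).
Hypotheses (cf : forall x y t, 0 <= t <= 1 ->
  f (x + t *: (y - x)) <= f x + t * (f y - f x)).
Hypotheses (Lf : euclid_lipschitz L (grad f)).
Hypotheses (alpha0 : 0 < alpha) (alphaL : alpha * L <= 1).

Lemma compact_enorm_diameter :
  exists2 D, 0 <= D & forall u v, X u -> X v -> enorm (u - v) <= D.
Proof.
have [M M0 hM] := pinfty_ex_gt0 (compact_bounded Xcpt).
exists (p%:R * (M + M)); first by rewrite mulr_ge0// addr_ge0// ltW.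
move=> u v Xu Xv; apply: le_trans (enorm_le_norm _) _; rewrite ler_wpM2l//.
by apply: le_trans (ler_normB _ _) _; rewrite lerD// hM.
Qed.

(** Combines the descent lemma from x to q, the gradient inequality from x to z, the obtuse angle at
    q and Cauchy-Schwarz for the gradient error. *)
Lemma projected_gradient_step D x z g b (q := Defs.proj X (x - alpha *: g)) :
  0 <= b <= 1 ->
  (forall u v, X u -> X v -> enorm (u - v) <= D) -> X z ->
  enorm (x + b *: (q - x) - z) ^+ 2 + 2 * alpha * b * (f q - f z) <=
  enorm (x - z) ^+ 2 + 2 * alpha * D * (b * enorm (g - grad f x)).
Proof.
move=> /andP[b0 b1] hD Xz.
have Xq : X q := (proj_in X (x - alpha *: g) X0 Xcpt).1.
have h1 := descent_lemma f L x q df Lf.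
have h2 := convex_grad_le f x z (cf x z) (df x).
have h3 := proj_inner_le0 X (x - alpha *: g) z X0 Xcpt Xcvx Xz; rewrite -/q in h3.
have h4 : inner (grad f x - g) (q - z) <= enorm (g - grad f x) * D.
  apply: le_trans (cauchy_schwarz _ _) _.
  by rewrite (enormB g) ler_wpM2l ?enorm_ge0// hD.
have h5 : 0 <= inner (q - x) (q - x) := inner_ge0 _.
pose a := x - z; pose c := q - z.
have Eqx : q - x = c - a by rewrite /c /a opprB addrA subrK.
have Ezx : z - x = - a by rewrite opprB.
have Ezq : z - q = - c by rewrite opprB.
have Exq : x - alpha *: g - q = a - c - alpha *: g.
  by rewrite addrAC /a /c opprB addrA subrK.
have En : x + b *: (q - x) - z = a + b *: (c - a) by rewrite addrAC Eqx.
rewrite En -/a !enorm_sqr; move: h1 h2 h3 h4 h5.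
rewrite enorm_sqr Exq Eqx Ezx Ezq -/c; move: (grad f x) (f q) (f z) (f x) => G fq fz fx.
clearbody a c; rewrite !inner_lin (innerC c a).
move: (inner a a) (inner c c) (inner a c) (inner G c) (inner G a) (inner g c).
move: (enorm _) => e A C I Gc Ga gc h1 h2 h3 h4 h5.
(* Estimate for the full step b = 1; alpha L <= 1 absorbs the quadratic term of the descent
   lemma. *)
have h6 : alpha * (fq - fz) <= alpha * (e * D) + (A - C) / 2.
  have : alpha * (fq - fz) <= alpha * (e * D + gc + L / 2 * (A - 2 * I + C)).
    by rewrite ler_wpM2l ?(ltW alpha0)//; lra.
  have : alpha * L * (A - 2 * I + C) <= A - 2 * I + C.
    by rewrite ler_piMl//; lra.
  lra.
have h7 : b * (alpha * (fq - fz)) <= b * (alpha * (e * D) + (A - C) / 2).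
  by rewrite ler_wpM2l.
have h8 : 0 <= b * (1 - b) * (A - 2 * I + C).
  by rewrite !mulr_ge0 ?subr_ge0//; lra.
by nra.
Qed.

Context (beta : nat -> R) (x g : nat -> 'cV[R]_p) (B : R).
Hypotheses (beta01 : forall k, 0 <= beta k <= 1).
Hypotheses (beta_inf : forall M, exists n, M < \sum_(0 <= k < n) beta k).
Hypotheses (Xx0 : X (x 0)).
Hypotheses (xS : forall k, x k.+1 =
  x k + beta k *: (Defs.proj X (x k - alpha *: g k) - x k)).
Hypotheses (gB : forall n,
  \sum_(0 <= k < n) beta k * enorm (g k - grad f (x k)) <= B).

Lemma inexact_projected_gradient_in k : X (x k).
Proof.
elim: k => // k Xk; rewrite xS; apply: convex_setE => //.
exact: (proj_in X _ X0 Xcpt).1.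
Qed.

Theorem inexact_projected_gradient :
  exists xs, [/\ X xs, forall z, X z -> f xs <= f z & x @ \oo --> xs].
Proof.
have Xx := inexact_projected_gradient_in.
have b0 k : 0 <= beta k by case/andP: (beta01 k).
have [D D0 hD] := compact_enorm_diameter.
have cff : continuous f by move=> z; exact: differentiable_continuous.
have [z /set_mem Xz hz] := compact_EVT_min X0 Xcpt (continuous_subspaceT cff).
have {}hz w : X w -> f z <= f w by move=> Xw; apply: hz; exact: mem_set.
pose q k := Defs.proj X (x k - alpha *: g k).
have Xq k : X (q k) := (proj_in X _ X0 Xcpt).1.
pose r k := beta k * enorm (g k - grad f (x k)).
have r0 k : 0 <= r k by rewrite mulr_ge0// enorm_ge0.
have step w k : X w ->
    enorm (x k.+1 - w) ^+ 2 + 2 * alpha * (beta k * (f (q k) - f w)) <=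
    enorm (x k - w) ^+ 2 + 2 * alpha * D * r k.
  move=> Xw; rewrite xS (mulrA (2 * alpha)); exact: projected_gradient_step.
(* Telescoping the step inequality controls the gaps at the projected points [q k]. *)
have sum1 n : enorm (x n - z) ^+ 2 +
    2 * alpha * \sum_(0 <= k < n) beta k * (f (q k) - f z) <=
    enorm (x 0 - z) ^+ 2 + 2 * alpha * D * \sum_(0 <= k < n) r k.
  elim: n => [|n IH]; first by rewrite !big_nil !mulr0.
  rewrite !big_nat_recr//= !(mulrDr (2 * alpha)) (mulrDr (2 * alpha * D)).
  have := step z n Xz; lra.
(* Convexity on the segment from [x k] to [q k] bounds f (x k.+1) - f (x k) by beta k (f (q k) - f
   (x k)); telescoping transfers the bound from [q k] to [x k]. *)
have sum2 n : f (x n) - f z + \sum_(0 <= k < n) beta k * (f (x k) - f z) <=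
    f (x 0) - f z + \sum_(0 <= k < n) beta k * (f (q k) - f z).
  elim: n => [|n IH]; first by rewrite !big_nil.
  rewrite !big_nat_recr//=.
  have := cf (x n) (q n) _ (beta01 n); rewrite -xS; lra.
pose B1 := f (x 0) - f z + (enorm (x 0 - z) ^+ 2 + 2 * alpha * D * B) / (2 * alpha).
have sum3 n : \sum_(0 <= k < n) beta k * (f (x k) - f z) <= B1.
  have h1 := sum1 n; have h2 := sum2 n; have h3 := hz _ (Xx n).
  have h4 := sqr_ge0 (enorm (x n - z)).
  have h5 : 2 * alpha * D * \sum_(0 <= k < n) r k <= 2 * alpha * D * B.
    by rewrite ler_wpM2l// !mulr_ge0// ltW.
  suff : \sum_(0 <= k < n) beta k * (f (q k) - f z) <=
    (enorm (x 0 - z) ^+ 2 + 2 * alpha * D * B) / (2 * alpha) by rewrite /B1; lra.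
  by rewrite ler_pdivlMr ?mulr_gt0// mulrC; lra.
have d0 k : 0 <= f (x k) - f z by rewrite subr_ge0 hz.
have liminf := weighted_sum_liminf0 _ _ _ b0 d0 beta_inf sum3.
(* Indices [s j] that tend to infinity and along which the gap vanishes; compactness gives [x \o s]
   a cluster point. *)
have /choice[s hs] j : exists k, (j <= k)%N /\ f (x k) - f z < j.+1%:R^-1.
  by have [|k jk hk] := liminf j.+1%:R^-1 j; [rewrite invr_gt0 | exists k].
have [|xs [Xxs xs_cl]] := Xcpt ((x \o s) @ \oo) _.
  by exists 0%N => // j _; exact: Xx.
have freq (A : set 'cV[R]_p) J : nbhs xs A -> exists2 j, (J <= j)%N & A (x (s j)).
  move=> hA; have [|w [[j Jj <-] Aw]] := xs_cl
    [set w | exists2 j, (J <= j)%N & x (s j) = w] A _ hA; last by exists j.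
  by exists J => // j/= Jj; exists j.
have xsmin : f xs <= f z.
  apply/ler_addgt0Pr => e e0; have e2 : 0 < e / 2 by rewrite divr_gt0.
  have [J _ hJ] := near_infty_natSinv_lt (PosNum e2).
  have /cvgrPdist_lt/(_ _ e2) hA := cff xs.
  have [j Jj /=] := freq _ J hA; rewrite ltr_norml => /andP[_ h1].
  have := lt_trans (hs j).2 (hJ j Jj : _ < e / 2); lra.
exists xs; split=> // [w Xw|]; first exact: le_trans xsmin (hz w Xw).
(* As [xs] is itself a minimizer, the step inequality centred at [xs] loses its function term. *)
have h1 k : enorm (x k.+1 - xs) ^+ 2 <= enorm (x k - xs) ^+ 2 + 2 * alpha * D * r k.
  have := step xs k Xxs.
  have : 0 <= 2 * alpha * (beta k * (f (q k) - f xs)).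
    rewrite !mulr_ge0 ?(ltW alpha0)// subr_ge0.
    exact: le_trans xsmin (hz _ (Xq k)).
  lra.
have aD0 : 0 <= 2 * alpha * D by rewrite !mulr_ge0// ltW.
have h2 k : 0 <= 2 * alpha * D * r k by rewrite mulr_ge0.
have h3 n : \sum_(0 <= k < n) 2 * alpha * D * r k <= 2 * alpha * D * B.
  by rewrite -mulr_sumr ler_wpM2l.
(* Being a cluster point, [xs] is approached at arbitrarily late indices; quasi-monotonicity then
   turns this into convergence. *)
have h4 e K : 0 < e -> exists2 k, (K <= k)%N & enorm (x k - xs) ^+ 2 < e.
  move=> e0; have se : 0 < Num.sqrt e by rewrite sqrtr_gt0.
  have /(@cvgrPdist_lt _ _ _ (nbhs xs) (nbhs_filter xs))/(_ _ se) hA :=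
    enorm_continuous xs xs.
  have [j Kj /=] := freq _ K hA.
  rewrite subrr enorm0 sub0r normrN ger0_norm ?enorm_ge0// => h.
  exists (s j); first exact: leq_trans Kj (hs j).1.
  by rewrite enormB -(sqr_sqrtr (ltW e0)) ltr_pXn2r// nnegrE ?enorm_ge0 ?ltW.
have h5 := quasi_monotone_cvg0 _ _ _ h2 h3 h1 h4.
apply/cvgrPdist_lt => e e0; have [|K hK] := h5 (e ^+ 2); first by rewrite exprn_gt0.
exists K => // k /= Kk; apply: le_lt_trans (norm_le_enorm _) _.
by rewrite enormB -(@ltr_pXn2r _ 2) ?hK// nnegrE ?enorm_ge0 ?ltW.
Qed.

End InexactProjectedGradient.

(** * Affine variational inequalities and the game *)

Section MatrixKernel.
Context {R : realType}.

Lemma unitmx_ker0 n (A : 'M[R]_n) :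
  (forall v : 'cV[R]_n, A *m v = 0 -> v = 0) -> A \in unitmx.
Proof.
move=> hA; rewrite -unitmx_tr -row_free_unit -kermx_eq0; apply/rowV0P => u.
move=> /sub_kermxP /(congr1 trmx); rewrite trmx_mul trmxK trmx0 => /hA.
by move=> /(congr1 trmx); rewrite trmxK trmx0.
Qed.

(** C C^T v = 0 forces |C^T v|^2 = 0, and C^T is injective by full row rank. *)
Lemma gram_unitmx p n (C : 'M[R]_(p, n)) : row_free C -> C *m C^T \in unitmx.
Proof.
move=> Cfree; apply: unitmx_ker0 => v Cv.
have /inner_eq0 /(congr1 trmx) : inner (C^T *m v) (C^T *m v) = 0.
  by rewrite inner_mulmx trmxK mulmxA Cv inner0l.
rewrite trmx_mul trmxK trmx0 => /eqP; rewrite mulmx_free_eq0// => /eqP.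
by move=> /(congr1 trmx); rewrite trmxK trmx0.
Qed.

Lemma mulmx_inj_cV p n (A B : 'M[R]_(p, n)) :
  (forall v : 'cV[R]_n, A *m v = B *m v) -> A = B.
Proof.
by move=> AB; apply/matrixP => i j; have /colP/(_ i) := AB (delta_mx j 0);
  rewrite -!colE !mxE.
Qed.

Lemma Jac_affine p q (A : 'M[R]_(q, p)) (f : 'cV[R]_p -> 'cV[R]_q) u :
  (forall v w, f (v + w) = f v + A *m w) -> Jac f u = A.
Proof.
move=> hf; apply/matrixP => i j; rewrite mxE.
have [_ ->] : is_derive u (delta_mx j 0) f (A *m delta_mx j 0).
  apply: (@is_derive_quadratic _ _ _ _ _ _ _ 0) => h.
  by rewrite hf scaler0 addr0 -scalemxAr.
by rewrite -colE mxE.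
Qed.

End MatrixKernel.

(** * Affine variational inequalities on a translated subspace *)

Section AffineVI.
Context {R : realType} {n : nat}.
Context (Z M : 'M[R]_n) (mu : R).
Hypotheses (Zsym : Z^T = Z) (Zid : Z *m Z = Z).
Hypotheses (mu0 : 0 < mu).
Hypotheses (Mmon : forall u, mu * inner u u <= inner (M *m u) u).

(* For an orthogonal projection Z with Z g = 0, this is g + range Z. *)
Definition affine_set (g : 'cV[R]_n) : set 'cV[R]_n := [set y | y = g + Z *m y].

Lemma inner_proj u v : inner u (Z *m v) = inner (Z *m u) v.
Proof. by rewrite inner_mulmx Zsym. Qed.

Lemma mem_affine_set g u : Z *m g = 0 -> affine_set g (g + Z *m u).
Proof. by move=> Zg; rewrite /affine_set/= mulmxDr Zg add0r mulmxA Zid. Qed.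

Lemma affine_setB g v w : affine_set g v -> affine_set g w ->
  w - v = Z *m (w - v).
Proof. by move=> hv hw; rewrite {1}hv {1}hw opprD addrACA subrr add0r mulmxBr. Qed.

(** Z kills the residual u - (g + Z u), while differences of points of the set lie in the range of
    Z: the angle is right. *)
Lemma proj_affine_set g u : Z *m g = 0 ->
  Defs.proj (affine_set g) u = g + Z *m u.
Proof.
move=> Zg; apply: proj_unique => [|w hw]; first exact: mem_affine_set.
rewrite (affine_setB g _ _ (mem_affine_set g u Zg) hw) inner_proj mulmxBr mulmxDr.
by rewrite Zg add0r mulmxA Zid subrr inner0l.
Qed.

Lemma enorm_proj_le u : enorm (Z *m u) <= enorm u.
Proof.
apply: enorm_le_sqr; first exact: enorm_ge0.
rewrite enorm_sqr inner_proj mulmxA Zid.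
have := inner_ge0 (u - Z *m u); rewrite !inner_lin !inner_proj !mulmxA Zid; lra.
Qed.

(* Z M Z on range Z and the identity on ker Z: unlike Z M Z it is invertible. *)
Definition reduced_mx : 'M[R]_n := Z *m M *m Z + (1%:M - Z).

(** Pairing a kernel vector v with its image gives <M Z v, Z v> + |v - Z v|^2 = 0, so strong
    monotonicity makes both Z v and v - Z v vanish. *)
Lemma reduced_mx_unit : reduced_mx \in unitmx.
Proof.
apply: unitmx_ker0 => v; rewrite /reduced_mx mulmxDl mulmxBl mul1mx -!mulmxA => hv.
have h1 : inner (M *m (Z *m v)) (Z *m v) + inner (v - Z *m v) (v - Z *m v) = 0.
  transitivity (inner (Z *m (M *m (Z *m v)) + (v - Z *m v)) v); last first.
    by rewrite hv inner0l.
  rewrite [RHS]innerDl -(inner_proj _ v); congr (_ + _).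
  by rewrite innerDr innerNr inner_proj mulmxBr mulmxA Zid subrr inner0l subr0.
have h2 := Mmon (Z *m v); have h3 := inner_ge0 (v - Z *m v).
have h4 := inner_ge0 (Z *m v).
have h5 : mu * inner (Z *m v) (Z *m v) = 0.
  by apply/le_anti; rewrite (mulr_ge0 (ltW mu0))// andbT; lra.
have /inner_eq0 h6 : inner (Z *m v) (Z *m v) = 0.
  by move/eqP: h5; rewrite mulf_eq0 (gt_eqF mu0) => /eqP.
by move: h1; rewrite h6 subr0 innerC inner0l add0r => /inner_eq0.
Qed.

(** Solves Z (M y + q) = 0 with y = g - t and t in the range of Z. *)
Definition reduced_sol (g q : 'cV[R]_n) : 'cV[R]_n :=
  g - invmx reduced_mx *m (Z *m (M *m g + q)).

(** Multiplying the equation for t by 1 - Z gives (1 - Z) t = 0, so t lies in the range of Z, where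
    [reduced_mx] acts as Z M. *)
Lemma reduced_solP g q : Z *m g = 0 ->
  affine_set g (reduced_sol g q) /\ Z *m (M *m reduced_sol g q + q) = 0.
Proof.
move=> Zg; rewrite /reduced_sol; set t := _ *m (Z *m _).
have Kt : reduced_mx *m t = Z *m (M *m g + q).
  by rewrite mulmxA mulmxV ?reduced_mx_unit// mul1mx.
have tZ : Z *m t = t.
  have PZ : (1%:M - Z) *m Z = 0 by rewrite mulmxBl mul1mx Zid subrr.
  have PK : (1%:M - Z) *m reduced_mx = 1%:M - Z.
    rewrite /reduced_mx mulmxDr -!mulmxA mulmxA PZ mul0mx add0r.
    by rewrite mulmxBr PZ mulmx1 subr0.
  have := congr1 (mulmx (1%:M - Z)) Kt.
  rewrite mulmxA [RHS]mulmxA PK PZ mul0mx mulmxBl mul1mx => /eqP.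
  by rewrite subr_eq0 => /eqP.
have ZMt : Z *m (M *m t) = Z *m (M *m g + q).
  by rewrite -Kt /reduced_mx mulmxDl mulmxBl mul1mx tZ subrr addr0 -!mulmxA tZ.
split; first by rewrite /affine_set/= mulmxBr Zg add0r tZ.
by rewrite mulmxBr addrAC mulmxBr ZMt subrr.
Qed.

(** At [reduced_sol] the operator is orthogonal to all feasible directions, so the inequality holds
    with equality; strong monotonicity excludes a second solution. *)
Lemma VI_affine_set g q : Z *m g = 0 ->
  VI_sol (fun y => M *m y + q) (affine_set g) = reduced_sol g q.
Proof.
move=> Zg; have [] := reduced_solP g q Zg; move: (reduced_sol g q) => ys Fys Zf.
have VIys w : affine_set g w -> inner (M *m ys + q) (w - ys) = 0.
  by move=> hw; rewrite (affine_setB g _ _ Fys hw) inner_proj Zf inner0l.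
apply: (@xget_unique _ 0 [set v | affine_set g v /\ forall w, affine_set g w -> _]).
  by split=> // w /VIys ->.
move=> v [Fv hv]; have h1 := hv _ Fys; have h2 := VIys _ Fv; have h3 := Mmon (v - ys).
have h4 := inner_ge0 (v - ys).
apply/eqP; rewrite -subr_eq0; apply/eqP/inner_eq0.
have h5 : inner (M *m (v - ys)) (v - ys) =
    inner (M *m v + q) (v - ys) - inner (M *m ys + q) (v - ys).
  by rewrite -innerNl -innerDl mulmxBr opprD addrACA subrr addr0.
have h6 : inner (M *m v + q) (v - ys) <= 0.
  by rewrite -opprB innerNr oppr_le0.
have h7 : mu * inner (v - ys) (v - ys) = 0.
  by apply/le_anti; rewrite (mulr_ge0 (ltW mu0))// andbT; lra.
by move/eqP: h7; rewrite mulf_eq0 (gt_eqF mu0) => /eqP.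
Qed.

(** Z is nonexpansive, and |u - gamma M u|^2 <= k2 |u|^2, where k2 < 1 is exactly the bound on
    gamma. *)
Lemma contraction_factor gamma L : 0 < gamma < 2 * mu / L ^+ 2 ->
  (forall u, enorm (M *m u) <= L * enorm u) ->
  exists2 kappa, 0 <= kappa < 1 &
    forall u, enorm ((Z - gamma *: (Z *m M)) *m u) <= kappa * enorm u.
Proof.
move=> /andP[g0 gL] ML.
(* Division by zero yields 0, so L = 0 would leave no admissible gamma. *)
have L20 : 0 < L ^+ 2.
  rewrite lt_neqAle sqr_ge0 andbT eq_sym; apply/negP => /eqP L0.
  by move: (lt_trans g0 gL); rewrite L0 invr0 mulr0 ltxx.
pose k2 := 1 - 2 * gamma * mu + gamma ^+ 2 * L ^+ 2.
have k21 : k2 < 1.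
  move: gL; rewrite ltr_pdivlMr// /k2 => gL.
  have : gamma * (gamma * L ^+ 2) < gamma * (2 * mu) by rewrite ltr_pM2l.
  lra.
(* In dimension 0 nothing relates mu and L, so [k2] may be negative and is truncated. *)
exists (Num.sqrt (Num.max 0 k2)).
  by rewrite sqrtr_ge0 -sqrtr1 ltr_sqrt// gt_max ltr01.
move=> u; rewrite mulmxBl -scalemxAl -mulmxA scalemxAr -mulmxBr.
apply: le_trans (enorm_proj_le _) _; apply: enorm_le_sqr.
  by rewrite mulr_ge0 ?sqrtr_ge0 ?enorm_ge0.
rewrite exprMn sqr_sqrtr ?le_max ?lexx// enorm_sqr.
apply: (@le_trans _ _ (k2 * inner u u)); last first.
  by rewrite ler_wpM2r ?inner_ge0// le_max lexx orbT.
have h1 : inner (M *m u) (M *m u) <= L ^+ 2 * inner u u.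
  rewrite -!enorm_sqr -exprMn -(ger0_norm (enorm_ge0 (M *m u))).
  rewrite -(real_normK (num_real (L * _))).
  rewrite ler_pXn2r ?nnegrE// (ger0_norm (enorm_ge0 _)).
  exact: le_trans (ML u) (ler_norm _).
have h2 : gamma * (mu * inner u u) <= gamma * inner (M *m u) u.
  by rewrite ler_pM2l.
have h3 : gamma ^+ 2 * inner (M *m u) (M *m u) <= gamma ^+ 2 * (L ^+ 2 * inner u u).
  by rewrite ler_wpM2l ?sqr_ge0.
rewrite !inner_lin (innerC u (M *m u)) /k2; lra.
Qed.

End AffineVI.

(** * The game in matrix form *)

Section GameAffine.
Context {R : realType} {m N : nat} {n_ p_ : 'I_N -> nat}.
Context (G : lqgame R m n_ p_).
Local Notation n := (\sum_i n_ i)%N.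
Hypotheses (hQ : forall i, sym_posdef (lqQ G i)).
Hypotheses (hC : forall i, row_free (lqC G i)).

(* The transpose comes from the gradient of (E_ii y_i)^T y_i, which is quadratic
   in y_i. *)
Definition game_mx : 'M[R]_n :=
  \mxdiag_i (lqQ G i + (lqE G i i)^T) + \mxblock_(i, j) lqE G i j.

Definition game_mx0 : 'M[R]_(n, m) := \mxcol_i lqE0 G i.

Definition game_cst : 'cV[R]_n := \mxcol_i lqe G i.

Lemma sum_set_block (y : 'cV[R]_n) i h (w : 'cV[R]_(n_ i)) :
  \sum_j lqE G i j *m submxcol (set_block y (submxcol y i + h *: w)) j =
  \sum_j lqE G i j *m submxcol y j + h *: (lqE G i i *m w).
Proof.
rewrite (bigD1 i)// [in RHS](bigD1 i)//= mxcolK dfwithin mulmxDr -scalemxAr.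
rewrite addrAC; congr (_ + _ + _); apply: eq_bigr => j ji.
by rewrite mxcolK dfwithout// eq_sym.
Qed.

(** Each cost is exactly quadratic in the follower's own block; symmetry of Q merges the two cross
    terms. *)
Lemma pseudo_gradE x (y : 'cV[R]_n) :
  pseudo_grad G x y = game_mx *m y + (game_mx0 *m x + game_cst).
Proof.
rewrite -[y in RHS]submxcolK mulmxDl mul_mxdiag_mxcol mul_mxblock_mxrow mxcol_mul.
rewrite -!mxcolD; apply: eq_mxcol => i; apply/colP => k; rewrite mxE.
set v := submxcol y i.
set l := \sum_j lqE G i j *m submxcol y j + lqE0 G i *m x + lqe G i.
have [Qsym _] := hQ i.
set d := delta_mx k 0.
suff [_ ->] : is_derive v d (fun w => cost G i x (set_block y w))
    (inner ((lqQ G i + (lqE G i i)^T) *m v + l) d).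
  by rewrite inner_delta /l -!addrA.
apply: (@is_derive_quadratic _ _ _ _ _ _ _
  (2^-1 * inner d (lqQ G i *m d) + inner (lqE G i i *m d) d)) => h.
rewrite /cost -/v !sum_set_block !mxcolK !dfwithin -/v.
have -> : \sum_j lqE G i j *m submxcol (set_block y v) j =
   \sum_j lqE G i j *m submxcol y j.
  by have := sum_set_block y i 0 d; rewrite !scale0r !addr0.
rewrite -/l (addrAC _ (h *: _)) (addrAC _ (h *: _)) -/l mulmxDr -scalemxAr.
have Qdv : inner d (lqQ G i *m v) = inner v (lqQ G i *m d).
  by rewrite inner_mulmx Qsym innerC.
rewrite mulmxDl; clearbody l; rewrite !inner_lin /GRing.scale/= (innerC (_ *m v) d) Qdv.
rewrite -(inner_mulmx _ v d) (innerC (lqE G i i *m d) v).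
by field.
Qed.

(** The Moore-Penrose inverse of C_i, a right inverse by full row rank. *)
Definition constraint_pinv i : 'M[R]_(n_ i, p_ i) :=
  (lqC G i)^T *m invmx (lqC G i *m (lqC G i)^T).

(** The orthogonal projection onto the product of the kernels of the C_i. *)
Definition kernel_proj : 'M[R]_n := \mxdiag_i (1%:M - constraint_pinv i *m lqC G i).

(** With [feasible_cst], this gives the feasible point of least norm as an affine function of x. *)
Definition feasible_mx : 'M[R]_(n, m) := \mxcol_i (constraint_pinv i *m lqH G i).

Definition feasible_cst : 'cV[R]_n := \mxcol_i (constraint_pinv i *m lqd G i).

Lemma constraint_pinvK i : lqC G i *m constraint_pinv i = 1%:M.
Proof. by rewrite mulmxA mulmxV// gram_unitmx. Qed.

Lemma kernel_proj_mxcol q (v : forall i, 'M[R]_(n_ i, q)) :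
  kernel_proj *m \mxcol_i v i =
  \mxcol_i (v i - constraint_pinv i *m (lqC G i *m v i)).
Proof.
rewrite mul_mxdiag_mxcol; apply: eq_mxcol => i.
by rewrite mulmxBl mul1mx mulmxA.
Qed.

Lemma kernel_proj_sym : kernel_proj^T = kernel_proj.
Proof.
rewrite tr_mxdiag; apply: eq_mxdiag => i.
rewrite linearB/= trmx1 /constraint_pinv !trmx_mul trmxK trmx_inv.
by rewrite trmx_mul trmxK mulmxA.
Qed.

Lemma kernel_proj_idem : kernel_proj *m kernel_proj = kernel_proj.
Proof.
apply: mulmx_inj_cV => v; rewrite -mulmxA -[v]submxcolK !kernel_proj_mxcol.
apply: eq_mxcol => i; rewrite mulmxBr (mulmxA _ (constraint_pinv i)).
by rewrite constraint_pinvK mul1mx subrr mulmx0 subr0.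
Qed.

Lemma kernel_proj_feasible x : kernel_proj *m (feasible_mx *m x + feasible_cst) = 0.
Proof.
rewrite mxcol_mul -mxcolD kernel_proj_mxcol -[RHS]mxcol0.
apply: eq_mxcol => i; rewrite -(mulmxA _ (lqH G i)) -mulmxDr.
rewrite (mulmxA (lqC G i) (constraint_pinv i)).
by rewrite constraint_pinvK mul1mx subrr.
Qed.

Lemma feasibleE x :
  feasible G x = affine_set kernel_proj (feasible_mx *m x + feasible_cst).
Proof.
apply/seteqP; split=> y; rewrite /feasible /affine_set/= => hy.
  rewrite -[y]submxcolK kernel_proj_mxcol mxcol_mul -!mxcolD.
  apply: eq_mxcol => i; rewrite hy -(mulmxA _ (lqH G i)) -mulmxDr.
  by rewrite (addrC (lqd G i)) [RHS]addrC subrK.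
move=> i; rewrite hy -[y]submxcolK kernel_proj_mxcol mxcol_mul -!mxcolD mxcolK.
rewrite -(mulmxA _ (lqH G i)) -mulmxDr (mulmxDr (lqC G i)) (mulmxBr (lqC G i)).
rewrite !(mulmxA (lqC G i) (constraint_pinv i)) constraint_pinvK.
by rewrite !mul1mx subrr addr0 addrC.
Qed.

Definition J2_mx gamma : 'M[R]_n := kernel_proj - gamma *: (kernel_proj *m game_mx).

Definition J1_mx gamma : 'M[R]_(n, m) :=
  feasible_mx - gamma *: (kernel_proj *m game_mx0).

Lemma hmapE gamma x y : hmap G gamma x y =
  J1_mx gamma *m x + J2_mx gamma *m y +
  (feasible_cst - gamma *: (kernel_proj *m game_cst)).
Proof.
rewrite /hmap feasibleE (proj_affine_set _ kernel_proj_sym kernel_proj_idem);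
  last exact: kernel_proj_feasible.
rewrite pseudo_gradE mulmxBr -scalemxAr !mulmxDr !scalerDr /J1_mx /J2_mx !mulmxBl.
rewrite -!scalemxAl !mulmxA.
move: (feasible_mx *m x) feasible_cst (kernel_proj *m y) => a b c.
move: (_ *: _) (_ *: _) (_ *: _) => d e f.
by apply/colP => i; rewrite !mxE; ring.
Qed.

Lemma J2hE gamma x y : J2h G gamma x y = J2_mx gamma.
Proof.
by apply: Jac_affine => u v; rewrite !hmapE mulmxDr [RHS]addrAC (addrA (J1_mx _ *m x)).
Qed.

Lemma J1hE gamma x y : J1h G gamma x y = J1_mx gamma.
Proof.
apply: Jac_affine => u v; rewrite !hmapE mulmxDr -!addrA; congr (_ + _).
by rewrite addrC -!addrA.
Qed.

Context (mu : R).
Hypotheses (mu0 : 0 < mu) (hmon : forall x, strongly_monotone mu (pseudo_grad G x)).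

Lemma game_mx_mon u : mu * inner u u <= inner (game_mx *m u) u.
Proof.
have := hmon 0 u 0; rewrite !pseudo_gradE !mulmx0 !add0r addrK subr0.
by rewrite enorm_sqr.
Qed.

Lemma game_mx_lipschitz L u : (forall x, euclid_lipschitz L (pseudo_grad G x)) ->
  enorm (game_mx *m u) <= L * enorm u.
Proof.
move=> hL; have := hL 0 u 0; rewrite !pseudo_gradE !mulmx0.
by rewrite !add0r addrK subr0.
Qed.

(** The part of [reduced_sol] that is linear in x. *)
Definition ystar_mx : 'M[R]_(n, m) := feasible_mx -
  invmx (reduced_mx kernel_proj game_mx) *m
    (kernel_proj *m (game_mx *m feasible_mx + game_mx0)).

Definition ystar_cst : 'cV[R]_n := reduced_sol kernel_proj game_mx feasible_cst game_cst.

Let ystar_reduced x : ystar G x = reduced_sol kernel_proj game_mx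
  (feasible_mx *m x + feasible_cst) (game_mx0 *m x + game_cst).
Proof.
rewrite /ystar feasibleE.
rewrite -(VI_affine_set _ _ _ kernel_proj_sym kernel_proj_idem mu0 game_mx_mon);
  last exact: kernel_proj_feasible.
by congr VI_sol; apply/funext => y; rewrite pseudo_gradE.
Qed.

Lemma ystarE x : ystar G x = ystar_mx *m x + ystar_cst.
Proof.
rewrite ystar_reduced /ystar_cst /reduced_sol /ystar_mx mulmxBl addrACA -opprD.
congr (_ - _); rewrite -!mulmxA -!mulmxDr; do 2 congr (_ *m _).
by rewrite (mulmxDl (game_mx *m _)) (mulmxDr game_mx) -!mulmxA addrACA.
Qed.

(** At the equilibrium Z annihilates the pseudo-gradient, so projecting undoes the gradient step. *)
Lemma hmap_ystar gamma x : hmap G gamma x (ystar G x) = ystar G x.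
Proof.
rewrite ystar_reduced; set g := _ + feasible_cst; set q := _ + game_cst.
have [Fy Zf] := reduced_solP _ _ _ kernel_proj_sym kernel_proj_idem mu0 game_mx_mon
  g q (kernel_proj_feasible x).
rewrite /hmap feasibleE (proj_affine_set _ kernel_proj_sym kernel_proj_idem);
  last exact: kernel_proj_feasible.
by rewrite pseudo_gradE mulmxBr -scalemxAr Zf scaler0 subr0 -Fy.
Qed.

(** Compares the linear parts in x of h(x, y*(x)) = y*(x); thus W is a fixed point of the recursion
    for s^k. *)
Lemma ystar_mx_fixpoint gamma : ystar_mx = J2_mx gamma *m ystar_mx + J1_mx gamma.
Proof.
apply: mulmx_inj_cV => x; apply: (addIr ystar_cst).
have := hmap_ystar gamma 0; rewrite ystarE hmapE !mulmx0 !add0r => h0.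
have := hmap_ystar gamma x; rewrite ystarE hmapE mulmxDr => <-.
by rewrite -[in RHS]h0 mulmxDl -mulmxA !addrA (addrC (J1_mx _ *m x)).
Qed.

End GameAffine.

(** * The hypergradient *)

(** Both difference quotients are the same function of h. This links derivatives on R^m or R^n to
    those of phi on the product. *)
Lemma derive_line_eq {R : realType} {U V W : normedModType R} (f : U -> W)
    (g : V -> W) a u b v : (forall h : R, f (h *: u + a) = g (h *: v + b)) ->
  'D_u f a = 'D_v g b.
Proof.
move=> fg; have fa : f a = g b by have := fg 0; rewrite !scale0r !add0r.
have E : (fun h : R => h^-1 *: ((f \o shift a) (h *: u) - f a)) =
         (fun h : R => h^-1 *: ((g \o shift b) (h *: v) - g b)).
  by apply/funext => h /=; rewrite fg fa.
by rewrite /derive E.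
Qed.

Section AffineGraph.
Context {R : realType} {m N : nat} {n_ : 'I_N -> nat}.
Local Notation n := (\sum_i n_ i)%N.
Context (phi : 'cV[R]_m * 'cV[R]_n -> R) (W : 'M[R]_(n, m)) (w : 'cV[R]_n).
Hypotheses (dphi : forall z, differentiable phi z).

Let graph x := (x, W *m x + w).
Let f x := phi (graph x).

Lemma lipschitz_enorm p (g : 'cV[R]_m * 'cV[R]_n -> 'cV[R]_p) : lipschitz g ->
  exists2 L, 0 <= L & forall z z',
    enorm (g z - g z') <= L * (enorm (z.1 - z'.1) + enorm (z.2 - z'.2)).
Proof.
move=> /pinfty_ex_gt0[L L0 hL]; exists (p%:R * L); first by rewrite mulr_ge0// ltW.
move=> z z'; apply: le_trans (enorm_le_norm _) _; rewrite -mulrA ler_wpM2l//.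
apply: le_trans (hL (z, z') _) _ => //=; rewrite ler_pM2l//.
have h1 := norm_le_enorm (z.1 - z'.1); have h2 := norm_le_enorm (z.2 - z'.2).
rewrite prod_normE/= ge_max; apply/andP; split.
  by apply: le_trans h1 _; rewrite lerDl enorm_ge0.
by apply: le_trans h2 _; rewrite lerDr enorm_ge0.
Qed.

Lemma graph_differentiable x : differentiable f x.
Proof.
apply: (@differentiable_comp _ _ _ _ graph phi) => //.
apply: differentiable_pair; first exact: ex_diff.
apply: differentiableD; last exact: ex_diff.
apply: (@linear_differentiable _ _ _ (mulmx W)).
apply/bounded_linear_continuous/linear_boundedP.
have [c c0 hc] := mulmx_enorm_bound W.
near=> r => v; apply: le_trans (norm_le_enorm _) _; apply: le_trans (hc v) _.
apply: (@le_trans _ _ (c * (m%:R * `|v|))).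
  by rewrite ler_wpM2l// enorm_le_norm.
rewrite mulrA ler_wpM2r//; near: r; exact: nbhs_pinfty_ge.
Unshelve. all: by end_near. Qed.

Lemma graph_convex : convex_function setT phi -> forall x y t, 0 <= t <= 1 ->
  f (x + t *: (y - x)) <= f x + t * (f y - f x).
Proof.
move=> /convex_functionE cphi x y t t01.
have := cphi (graph x) (graph y) t t01; congr (phi _ <= _).
congr (_, _) => /=.
rewrite mulmxDr -scalemxAr mulmxBr opprD addrACA subrr addr0.
by rewrite addrAC.
Qed.

(** Chain rule: the differential of phi at (v, W v) splits into its values at (v, 0) and (0, W v),
    and the transpose moves W across the inner product. *)
Lemma graph_grad x :
  grad f x = grad1 phi (graph x) + W^T *m grad2 phi (graph x).
Proof.
have D v : 'D_v f x = 'd phi (graph x) (v, W *m v).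
  rewrite -deriveE//; apply: derive_line_eq => h; congr (phi (_, _)) => /=.
  by rewrite mulmxDr -scalemxAr addrA.
have D1 v : 'd phi (graph x) (v, 0) = inner (grad1 phi (graph x)) v.
  rewrite /grad1 -derive_grad.
    rewrite -deriveE//; apply: derive_line_eq => h.
    by congr (phi (_, _)); rewrite /= scaler0 add0r.
  apply: differentiable_comp => //; apply: differentiable_pair; exact: ex_diff.
have D2 v : 'd phi (graph x) (0, v) = inner (grad2 phi (graph x)) v.
  rewrite /grad2 -derive_grad.
    rewrite -deriveE//; apply: derive_line_eq => h.
    by congr (phi (_, _)); rewrite /= scaler0 add0r.
  apply: differentiable_comp => //; apply: differentiable_pair; exact: ex_diff.
apply/colP => i; rewrite -!inner_delta -derive_grad; last exact: graph_differentiable.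
rewrite D innerDl -inner_mulmx -D1 -D2 -linearD/=.
by congr ('d phi _ (_, _)); rewrite /= ?addr0 ?add0r.
Qed.

End AffineGraph.

(** * Perturbed contractive recursions *)

Section Tracking.
Context {R : realType}.
Implicit Types (beta e : nat -> R) (kappa C B : R).

(** Monotone weights give beta_(k+1) e_(k+1) <= kappa beta_k e_k + C beta_k^2; summing leaves the
    factor 1 - kappa on the sum of the beta_k e_k. *)
Lemma tracking_sum_bounded beta e kappa C B : 0 <= kappa < 1 -> 0 <= C ->
  (forall k, 0 <= beta k.+1 <= beta k) -> (forall k, 0 <= e k) ->
  (forall k, e k.+1 <= kappa * e k + C * beta k) ->
  (forall n, \sum_(0 <= k < n) beta k ^+ 2 <= B) ->
  exists B', forall n, \sum_(0 <= k < n) beta k * e k <= B'.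
Proof.
move=> /andP[k0 k1] C0 hb e0 he hB; exists ((beta 0 * e 0 + C * B) / (1 - kappa)) => n.
have b0 k : 0 <= beta k.
  by case: k => [|k]; [have /andP[] := hb 0; apply: le_trans | case/andP: (hb k)].
suff h : beta n * e n + (1 - kappa) * \sum_(0 <= k < n) beta k * e k <=
    beta 0 * e 0 + C * \sum_(0 <= k < n) beta k ^+ 2.
  rewrite ler_pdivlMr ?subr_gt0// mulrC.
  have := ler_wpM2l C0 (hB n); have := mulr_ge0 (b0 n) (e0 n); lra.
elim: n => [|n IH]; first by rewrite !big_nil !mulr0.
rewrite !big_nat_recr//= !(mulrDr C) (mulrDr (1 - kappa)).
have h1 : beta n.+1 * e n.+1 <= beta n * e n.+1.
  by rewrite ler_wpM2r//; case/andP: (hb n).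
have h2 := ler_wpM2l (b0 n) (he n); lra.
Qed.

(** The bound is invariant under t |-> kappa t + C, whose fixed point is C / (1 - kappa). *)
Lemma tracking_bounded beta e kappa C : 0 <= kappa < 1 -> 0 <= C ->
  (forall k, beta k <= 1) -> (forall k, 0 <= e k) ->
  (forall k, e k.+1 <= kappa * e k + C * beta k) ->
  forall k, e k <= e 0 + C / (1 - kappa).
Proof.
move=> /andP[k0 k1] C0 b1 e0 he; have k1' : 0 < 1 - kappa by rewrite subr_gt0.
elim=> [|k IH]; first by rewrite lerDl divr_ge0// ltW.
have h1 := ler_wpM2l C0 (b1 k); have h2 := ler_wpM2l k0 IH.
have h3 : C / (1 - kappa) * (1 - kappa) = C by rewrite divfK// gt_eqF.
have h4 := he k; have h5 := mulr_ge0 (ltW k1') (e0 0).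
move: (C / (1 - kappa)) h2 h3 IH => q h2 h3 IH; lra.
Qed.

End Tracking.

Theorem theorem3 (R : realType) (S : ominimal R)
    (m N : nat) (n_ p_ : 'I_N -> nat) (G : lqgame R m n_ p_)
    (X : set 'cV[R]_m)
    (phi : 'cV[R]_m * 'cV[R]_(\sum_i n_ i) -> R)
    (mu L_F gamma L_Jphie alpha : R) (beta : nat -> R)
    (* followers *)
    (hQ : forall i, sym_posdef (lqQ G i))
    (hC : forall i, row_free (lqC G i))
    (hcvx : forall i x y, convex_function setT
       (fun v : 'cV[R]_(n_ i) => cost G i x (set_block y v)))
    (hmu : 0 < mu)
    (hmon : forall x, strongly_monotone mu (pseudo_grad G x))
    (hLF : forall x, euclid_lipschitz L_F (pseudo_grad G x))
    (* leader *)
    (hdef : definable S phi)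
    (hC1 : continuously_differentiable phi)
    (hlip1 : lipschitz (grad1 phi))
    (hlip2 : lipschitz (grad2 phi))
    (hX0 : X !=set0) (hXcvx : convex_set X) (hXcpt : compact X)
    (hphi : convex_function setT phi)
    (* step sizes *)
    (hgamma : 0 < gamma < 2 * mu / L_F ^+ 2)
    (hL : 0 < L_Jphie)
    (hLJ : euclid_lipschitz L_Jphie (grad (phi_e G phi)))
    (halpha : 0 < alpha <= L_Jphie^-1)
    (hbeta : forall k, 0 <= beta k.+1 <= beta k /\ beta k <= 1)
    (hbeta_sum : (\sum_(0 <= k <oo) (beta k)%:E = +oo)%E)
    (hbeta_sq : (\sum_(0 <= k <oo) ((beta k) ^+ 2)%:E < +oo)%E)
    (* initial point *)
    (x0 : 'cV[R]_m) (y0 : 'cV[R]_(\sum_i n_ i)) (s0 : 'M[R]_(\sum_i n_ i, m))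
    (hx0 : X x0) :
  exists xs : 'cV[R]_m,
    [/\ X xs,
        forall x, X x -> phi_e G phi xs <= phi_e G phi x
      & (fun k => (big_hype G phi X gamma (fun=> alpha) beta x0 y0 s0 k).1.1)
          @ \oo --> xs].
Proof.
have b0 k : 0 <= beta k.
  case: k => [|k]; last by have [/andP[]] := hbeta k.
  by have [/andP[h1 h2] _] := hbeta 0%N; exact: le_trans h1 h2.
have b01 k : 0 <= beta k <= 1 by rewrite b0; case: (hbeta k).
have bS k : 0 <= beta k.+1 <= beta k by case: (hbeta k).
have /andP[alpha0 alphaL] := halpha.
have binf := nneseries_unbounded _ b0 hbeta_sum.
have [B2 hB2] := nneseries_bounded _ (fun k => sqr_ge0 (beta k)) hbeta_sq.
have dphi := hC1.1.
pose W := ystar_mx G; pose w := ystar_cst G.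
have yE x : ystar G x = W *m x + w := ystarE G hQ hC mu hmu hmon x.
have fE : phi_e G phi = fun x => phi (x, W *m x + w).
  by apply/funext => x; rewrite /phi_e yE.
have df z : differentiable (phi_e G phi) z.
  by rewrite fE; exact: graph_differentiable.
have cf u v t : 0 <= t <= 1 -> phi_e G phi (u + t *: (v - u)) <=
    phi_e G phi u + t * (phi_e G phi v - phi_e G phi u).
  by rewrite fE; exact: graph_convex.
have gE u : grad (phi_e G phi) u =
    grad1 phi (u, ystar G u) + W^T *m grad2 phi (u, ystar G u).
  by rewrite fE yE; exact: graph_grad.
pose st := big_hype G phi X gamma (fun=> alpha) beta x0 y0 s0.
pose x k := (st k).1.1; pose y k := (st k).1.2; pose s k := (st k).2.
pose g k := hypergrad phi (x k) (y k) (s k).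
have xS k : x k.+1 = x k + beta k *: (Defs.proj X (x k - alpha *: g k) - x k).
  by rewrite /g /x /y /s /st/=; case: big_hype => [[]].
have yS k : y k.+1 = hmap G gamma (x k.+1) (y k).
  by rewrite /x /y /st/=; case: big_hype => [[]].
have sS k : s k.+1 = J2_mx G gamma *m s k + J1_mx G gamma.
  rewrite /s /st/=; case: big_hype => [[a b] c] /=.
  by rewrite (J2hE G hQ hC) (J1hE G hQ hC).
have Xx := inexact_projected_gradient_in X alpha hX0 hXcpt hXcvx beta x g b01 hx0 xS.
have [D D0 hD] := compact_enorm_diameter X hXcpt.
have Mmon := game_mx_mon G hQ mu hmon.
have ML u := game_mx_lipschitz G hQ L_F u hLF.
have [kappa kappa01 hkappa] := contraction_factor (kernel_proj G) (game_mx G) mu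
  (kernel_proj_sym G) (kernel_proj_idem G hC) Mmon gamma L_F hgamma ML.
have /andP[kappa0 kappa1] := kappa01.
have [cW cW0 hcW] := mulmx_enorm_bound W.
have [cS cS0 hcS] := mulmx_enorm_bound (s0 - W).
pose e k := enorm (y k - ystar G (x k)).
have e0 k : 0 <= e k := enorm_ge0 _.
(* y*(x^(k+1)) is fixed by h(x^(k+1), .), so the inner step contracts towards it; the target itself
   has moved by at most cW D beta^k. *)
have eS k : e k.+1 <= kappa * e k + kappa * (cW * D) * beta k.
  have -> : e k.+1 = enorm (J2_mx G gamma *m (y k - ystar G (x k.+1))).
    rewrite /e yS -{1}(hmap_ystar G hQ hC mu hmu hmon gamma) !(hmapE G hQ hC).
    by rewrite mulmxBr opprD addrACA subrr addr0 opprD addrACA subrr add0r.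
  apply: le_trans (hkappa _) _; rewrite -!mulrA -mulrDr ler_wpM2l//.
  rewrite -(subrK (ystar G (x k)) (y k)) -addrA.
  apply: le_trans (enormD _ _) _; rewrite lerD2l !yE opprD addrACA subrr addr0 -mulmxBr.
  apply: le_trans (hcW _) _; rewrite ler_wpM2l// xS opprD addrA subrr sub0r.
  rewrite enormN enormZ ger0_norm// mulrC ler_wpM2r//.
  by apply: hD => //; exact: (proj_in X _ hX0 hXcpt).1.
have kC0 : 0 <= kappa * (cW * D) by rewrite !mulr_ge0.
have [B1 hB1] := tracking_sum_bounded _ _ _ _ _ kappa01 kC0 bS e0 eS hB2.
have eB := tracking_bounded _ _ _ _ kappa01 kC0 (fun k => (andP (b01 k)).2) e0 eS.
set E := _ + _ in eB.
(* Subtracting the fixed point equation of W leaves a homogeneous recursion. *)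
have sE k v : enorm ((s k - W) *m v) <= kappa ^+ k * cS * enorm v.
  elim: k v => [|k IH] v; first by rewrite expr0 mul1r; exact: hcS.
  rewrite sS {1}/W (ystar_mx_fixpoint G hQ hC mu hmu hmon gamma) -/W.
  rewrite opprD addrACA subrr addr0 -mulmxBr -mulmxA.
  apply: le_trans (hkappa _) _; rewrite exprS -!mulrA ler_wpM2l// mulrA.
  exact: IH.
(* The tracking lemma again, for e_k = kappa^k and no perturbation. *)
have [B3 hB3] : exists B, forall n, \sum_(0 <= k < n) beta k * kappa ^+ k <= B.
  apply: (tracking_sum_bounded _ (fun k => kappa ^+ k) _ _ _ kappa01 (lexx 0) bS _ _ hB2).
    by move=> k; rewrite exprn_ge0.
  by move=> k; rewrite mul0r addr0 exprS.
have [L1 L10 hL1] := lipschitz_enorm _ _ hlip1.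
have [L2 L20 hL2] := lipschitz_enorm _ _ hlip2.
pose z0 := (x0, ystar G x0).
(* Bounds grad2 along the run: x^k is within D of x^0, and y^k within E + cW D of y*(x^0). *)
pose C2 := enorm (grad2 phi z0) + L2 * (D + (E + cW * D)).
have C2_ge k : enorm (grad2 phi (x k, y k)) <= C2.
  rewrite -(subrK (grad2 phi z0) (grad2 phi _)); apply: le_trans (enormD _ _) _.
  rewrite addrC lerD2l; apply: le_trans (hL2 _ _) _; rewrite ler_wpM2l//=.
  apply: lerD; first by apply: hD.
  rewrite -(subrK (ystar G (x k)) (y k)) -addrA.
  apply: le_trans (enormD _ _) _; apply: lerD; first exact: eB.
  rewrite !yE opprD addrACA subrr addr0 -mulmxBr.
  by apply: le_trans (hcW _) _; rewrite ler_wpM2l// hD.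
have gB k : enorm (g k - grad (phi_e G phi) (x k)) <=
    (L1 + cW * L2) * e k + cS * C2 * kappa ^+ k.
  (* Three errors: in grad1, in grad2 seen through W^T, and in the sensitivity s^k. The first two
     scale with e_k, the third with kappa^k. *)
  have -> : g k - grad (phi_e G phi) (x k) =
      (grad1 phi (x k, y k) - grad1 phi (x k, ystar G (x k))) +
      (W^T *m (grad2 phi (x k, y k) - grad2 phi (x k, ystar G (x k))) +
       (s k - W)^T *m grad2 phi (x k, y k)).
    have -> : (s k - W)^T = (s k)^T - W^T := linearB _ _ _.
    rewrite gE /g /hypergrad (mulmxBr W^T) (mulmxBl (s k)^T).
    move: (W^T *m grad2 phi (x k, y k)) (W^T *m _) ((s k)^T *m _).
    move: (grad1 _ _) (grad1 _ _).
    by move=> a1 a2 a3 a4 a5; apply/colP => i; rewrite !mxE; ring.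
  apply: le_trans (enormD _ _) _; apply: le_trans (lerD (lexx _) (enormD _ _)) _.
  rewrite mulrDl -addrA; apply: lerD; last apply: lerD.
  - by apply: le_trans (hL1 _ _) _; rewrite /= subrr enorm0 add0r.
  - apply: le_trans (trmx_enorm_bound _ _ cW0 hcW _) _; rewrite -mulrA ler_wpM2l//.
    by apply: le_trans (hL2 _ _) _; rewrite /= subrr enorm0 add0r.
  - have k0 : 0 <= kappa ^+ k * cS by rewrite mulr_ge0 ?exprn_ge0.
    apply: le_trans (trmx_enorm_bound _ _ k0 (sE k) _) _.
    by rewrite mulrC (mulrC _ cS) mulrA (mulrC _ cS) ler_wpM2r ?exprn_ge0// ler_wpM2l.
have [||xs [Xxs hmin hcvg]] := inexact_projected_gradient X (phi_e G phi) L_Jphie alpha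
  hX0 hXcpt hXcvx df cf hLJ alpha0 _ beta x g
  ((L1 + cW * L2) * B1 + cS * C2 * B3) b01 binf hx0 xS _.
- by rewrite -ler_pdivlMr// div1r.
- move=> n; have h1 := hB1 n; have h2 := hB3 n.
  apply: (@le_trans _ _ ((L1 + cW * L2) * (\sum_(0 <= k < n) beta k * e k) +
      cS * C2 * (\sum_(0 <= k < n) beta k * kappa ^+ k))).
    rewrite !mulr_sumr -big_split/=; apply: ler_sum => k _.
    by have := ler_wpM2l (b0 k) (gB k); lra.
  have C20 : 0 <= C2 := le_trans (enorm_ge0 _) (C2_ge 0).
  by apply: lerD; rewrite ler_wpM2l// ?addr_ge0 ?mulr_ge0.
by exists xs.
Qed.
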